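(* Let $n\ge2$ and let $A$ be a real $n\times n$ matrix such that $n-2$ of its rows are identical (all equal to some row vector $\mathbf b^T$) and the remaining two rows are identical to each other (both equal to some row vector $\mathbf a^T$). Then $\operatorname{dih}(A)=0$.
   Context: For $n\ge1$ and $k=1,\dots,n$, let $\rho_k$ be the permutation of $\{1,\dots,n\}$ with $\rho_k(1)=k,\rho_k(2)=k+1,\dots,\rho_k(n-k+1)=n,\rho_k(n-k+2)=1,\dots,\rho_k(n)=k-1$, and let $\mu_k$ be the permutation with $\mu_k(1)=k,\mu_k(2)=k-1,\dots,\mu_k(k)=1,\mu_k(k+1)=n,\mu_k(k+2)=n-1,\dots,\mu_k(n)=k+1$. For an $n\times n$ matrix $A=(a_{i,j})$, the dihedrant is $$\operatorname{dih}(A)=\sum_{k=1}^n\prod_{i=1}^n a_{i,\rho_k(i)}-\sum_{k=1}^n\prod_{i=1}^n a_{i,\mu_k(i)}.$$ *)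

(* Defs.v *)
From HB Require Import structures.
From mathcomp Require Import all_boot all_order all_fingroup all_algebra.
From mathcomp Require Import zify.

Set Implicit Arguments.
Unset Strict Implicit.
Unset Printing Implicit Defensive.

Import GRing.Theory.
Local Open Scope ring_scope.

(* Indices are shifted to start at 0: the integers 1, ..., n become the       *)
(* elements 0, ..., n-1 of 'I_n.                                              *)
Section DihedralPermutations.
Variables (n : nat) (k : 'I_n).

Definition rho_nat (i : nat) : nat :=
  if (k + i < n)%N then (k + i)%N else (k + i - n)%N.

Lemma rho_subproof (i : 'I_n) : (rho_nat i < n)%N.
Proof. by rewrite /rho_nat; have := ltn_ord i; have := ltn_ord k; case: ifP; lia. Qed.

Definition rho_fun (i : 'I_n) : 'I_n := Ordinal (rho_subproof i).

Lemma rho_fun_inj : injective rho_fun.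
Proof.
move=> i j /(congr1 val) /=; rewrite /rho_nat => Hij; apply: val_inj => /=.
by move: Hij (ltn_ord i) (ltn_ord j) (ltn_ord k); do 2!case: ifP; lia.
Qed.

Definition rho : 'S_n := perm rho_fun_inj.

Definition mu_nat (i : nat) : nat :=
  if (i <= k)%N then (k - i)%N else (n + k - i)%N.

Lemma mu_subproof (i : 'I_n) : (mu_nat i < n)%N.
Proof. by rewrite /mu_nat; have := ltn_ord i; have := ltn_ord k; case: ifP; lia. Qed.

Definition mu_fun (i : 'I_n) : 'I_n := Ordinal (mu_subproof i).

Lemma mu_fun_inj : injective mu_fun.
Proof.
move=> i j /(congr1 val) /=; rewrite /mu_nat => Hij; apply: val_inj => /=.
by move: Hij (ltn_ord i) (ltn_ord j) (ltn_ord k); do 2!case: ifP; lia.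
Qed.

Definition mu : 'S_n := perm mu_fun_inj.

End DihedralPermutations.

Definition dih (R : comNzRingType) (n : nat) (A : 'M[R]_n) : R :=
  \sum_(k < n) \prod_(i < n) A i (rho k i)
  - \sum_(k < n) \prod_(i < n) A i (mu k i).

(* Main.v *)
Require Import Defs.
From HB Require Import structures.
From mathcomp Require Import all_boot all_order all_fingroup all_algebra.
From mathcomp Require Import reals zify.

Import GRing.Theory.
Local Open Scope ring_scope.

(** If the two exceptional rows are [p] and [q], then modulo [n] the reflection
    [mu (k + p + q)] sends [p] to [k + q] and [q] to [k + p], i.e. it takes the
    values of the rotation [rho k] at [p] and [q] in swapped order.  As rows [p]
    and [q] agree, and all other rows agree, both permutations contribute the
    same product, and [k |-> k + p + q] matches rotations with reflections. *)

(** With indices starting at 0, [rho i j] is [i + j] modulo [n]. *)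
Lemma rhoC (n : nat) (i j : 'I_n) : rho i j = rho j i.
Proof. by apply: val_inj; rewrite !permE /= /rho_nat addnC. Qed.

(** Modulo [n], [mu m p] is [m - p], so [p] cancels from [p + q + k]. *)
Lemma mu_rho (n : nat) (p q k : 'I_n) : mu (rho (rho p q) k) p = rho k q.
Proof.
apply: val_inj; rewrite !permE /= /mu_nat /= /rho_nat /= /rho_nat.
have := ltn_ord p; have := ltn_ord q; have := ltn_ord k.
by repeat case: ifP; lia.
Qed.

Lemma prod_perm_swap (R : comNzRingType) (n : nat) (A : 'M[R]_n) (p q : 'I_n)
    (s t : 'S_n) :
    row p A = row q A ->
    (forall i j, i != p -> i != q -> j != p -> j != q -> row i A = row j A) ->
    s p = t q -> s q = t p ->
  \prod_i A i (s i) = \prod_i A i (t i).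
Proof.
(* Since [t (u i) = s i], [u] exchanges [p] and [q], hence maps each row to an equal one; reindexing
   by [u] matches the factors. *)
move=> rpq rother spq sqp; set u : 'S_n := (s * t^-1)%g.
have up : u p = q by rewrite permM spq permK.
have uq : u q = p by rewrite permM sqp permK.
have rowu i : row (u i) A = row i A.
  have [->|ip] := eqVneq i p; first by rewrite up.
  have [->|iq] := eqVneq i q; first by rewrite uq.
  have uip : u i != p by rewrite -[X in _ != X]uq (inj_eq perm_inj).
  have uiq : u i != q by rewrite -[X in _ != X]up (inj_eq perm_inj).
  exact: rother.
rewrite [RHS](reindex_inj (@perm_inj _ u)); apply: eq_bigr => i _.
have -> : t (u i) = s i by rewrite permM permKV.
by have /rowP/(_ (s i)) := rowu i; rewrite !mxE => ->.
Qed.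

Theorem theorem6 (R : realType) (n : nat) (hn : (2 <= n)%N) (A : 'M[R]_n)
    (a b : 'rV[R]_n) (p q : 'I_n) (hpq : p != q)
    (hp : row p A = a) (hq : row q A = a)
    (hb : forall i : 'I_n, i != p -> i != q -> row i A = b) :
  dih A = 0.
Proof.
apply/eqP; rewrite subr_eq0; apply/eqP.
rewrite [RHS](reindex_inj (@perm_inj _ (rho (rho p q)))).
apply: eq_bigr => k _; apply: (@prod_perm_swap _ _ _ p q).
- by rewrite hp hq.
- by move=> i j ip iq jp jq; rewrite !hb.
(* Symmetry of [p + q] lets [mu_rho] apply with [p] and [q] exchanged. *)
- by rewrite [rho p q]rhoC mu_rho.
- by rewrite mu_rho.
Qed.
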